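(* Let $\alpha\ge 1$ be an integer and let $F=N(\alpha)$, i.e. $n_F=n\,\alpha^{n-1}$ for $n\ge 1$ and $0_F=0$ (so $1_F=1$). Then for all integers $n,k\ge 0$ the $F$-nomial coefficient is equal to the number $\beta_{\alpha,n,k}$ of labeled bipartite $\alpha$-multigraphs $G(\alpha,n,k)$: $$\binom{n}{k}_{F}=\beta_{\alpha,n,k}.$$
   Context: For a sequence $F=\{n_F\}_{n\ge0}$ put $0_F!=1$, $n_F!=n_F\cdot(n-1)_F\cdots 1_F$, and for $0\le k\le n$ define the $F$-nomial coefficient $$\binom{n}{k}_F=\frac{n_F!}{k_F!\,(n-k)_F!}=\frac{n_F(n-1)_F\cdots(n-k+1)_F}{1_F\,2_F\cdots k_F};$$ it is $0$ for $k>n$. The sequence $N(\alpha)$ is the sequence of coefficients $n_F=[x^n]\,\frac{x}{(1-\alpha x)^2}$. A labeled bipartite $\alpha$-multigraph $G(\alpha,n,k)$ is a multigraph on the vertex set $\{1,\dots,n\}$ together with a (designated, ordered) partition of the vertices into two disjoint sets $V_1,V_2$ with $|V_1|=k$ and $|V_2|=n-k$, such that all edges join a vertex of $V_1$ to a vertex of $V_2$, and any such pair of vertices is joined by at most $\alpha-1$ (indistinguishable, undirected) edges. The choice of $V_1$ is part of the data (equivalently, vertices are colored with two distinguishable colors), so for instance for $\alpha=1$ such an object is just a $k$-subset of $\{1,\dots,n\}$. $\beta_{\alpha,n,k}$ denotes the number of these objects (it is $0$ for $k>n$). *)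

(* Defs.v *)
From mathcomp Require Import all_boot all_order all_algebra.
From mathcomp Require Import ring.

Set Implicit Arguments.
Unset Strict Implicit.
Unset Printing Implicit Defensive.

Import Order.TTheory GRing.Theory Num.Theory.
Local Open Scope ring_scope.

Definition Ffact (F : nat -> rat) (n : nat) : rat := \prod_(1 <= i < n.+1) F i.

Definition Fnomial (F : nat -> rat) (n k : nat) : rat :=
  if (k <= n)%N then Ffact F n / (Ffact F k * Ffact F (n - k)%N) else 0.

(* [F n] is the coefficient [x^n] (p / q): as formal power series
   q * \sum_n F n x^n = p.  Since q_0 != 0, this determines F. *)
Definition is_quot_coefs (p q : {poly rat}) (F : nat -> rat) : Prop :=
  q`_0 != 0 /\ forall n : nat, \sum_(i < n.+1) q`_i * F (n - i)%N = p`_n.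

Definition is_N (alpha : nat) (F : nat -> rat) : Prop :=
  is_quot_coefs 'X ((1 - alpha%:R *: 'X) ^+ 2) F.

(* Such a sequence exists, so hypotheses [is_N alpha F] are not vacuous. *)
Lemma is_N_exists (alpha : nat) : exists F : nat -> rat, is_N alpha F.
Proof.
set q := (1 - alpha%:R *: 'X : {poly rat}) ^+ 2.
have qE : q = 1 - (2 * alpha%:R) *: 'X + (alpha%:R ^+ 2) *: 'X^2.
  by rewrite /q sqrrB expr1n mul1r exprZn scalerMnl mulr_natl.
have q_i i : q`_i = (i == 0%N)%:R - 2 * alpha%:R * (i == 1%N)%:R
                    + alpha%:R ^+ 2 * (i == 2%N)%:R.
  by rewrite qE coefD coefB !coefZ coef1 coefX coefXn.
exists (fun n => n%:R * alpha%:R ^+ n.-1); split; rewrite -/q.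
  by rewrite q_i /= !mulr0 subr0 addr0 oner_eq0.
case=> [|[|n]].
- by rewrite big_ord1 coefX mul0r mulr0.
- by rewrite !big_ord_recl big_ord0 /= !q_i coefX /= !(mulr0, mul0r, mulr1, addr0, subr0).
rewrite !big_ord_recl big1 => [|i _]; last first.
  by rewrite q_i /= /bump /= !(mulr0, addr0, subr0, mul0r).
rewrite !q_i coefX /= /bump /= !subSS !subn0 addr0.
rewrite !(mulr0, mulr1, addr0, subr0, sub0r, add0r, mul1r) /=.
case: n => [|n] /=; first by ring.
by rewrite !exprS -[n.+3]addn3 -[n.+2]addn2 -[n.+1]addn1 !natrD; ring.
Qed.

(* An object is ((V1, V2), m).  The vertex i + 1 is represented by i : 'I_n, and
   m (x, y) is the number of (indistinguishable) edges joining x and y; it lies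
   in 'I_alpha, i.e. is at most alpha - 1, and is symmetric because edges are
   undirected. *)
Definition is_bip_multigraph (alpha n k : nat)
    (g : ({set 'I_n} * {set 'I_n}) * {ffun 'I_n * 'I_n -> 'I_alpha}) : bool :=
  let: ((V1, V2), m) := g in
  [&& V1 :|: V2 == [set: 'I_n], [disjoint V1 & V2],
      #|V1| == k, #|V2| == (n - k)%N,
      [forall x, forall y, m (x, y) == m (y, x)] &
      [forall x, forall y, (0 < m (x, y))%N ==>
         ((x \in V1) && (y \in V2)) || ((x \in V2) && (y \in V1))]].

Definition beta (alpha n k : nat) : nat :=
  #|[set g | @is_bip_multigraph alpha n k g]|.

(* Main.v *)
(** Both sides equal [binom n k * alpha ^ (k * (n - k))].  Comparing coefficients
    gives [n_F! = n! * alpha ^ (binom n 2)], and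
    [binom n 2 - binom k 2 - binom (n - k) 2 = k * (n - k)].  On the other side,
    a multigraph is a choice of [V1] together with an arbitrary multiplicity in
    [{0, ..., alpha - 1}] for each of the [k * (n - k)] pairs in [V1 * V2]. *)
Require Import Defs.
From mathcomp Require Import all_boot all_order all_algebra.
From mathcomp Require Import ring.

Set Implicit Arguments.
Unset Strict Implicit.
Unset Printing Implicit Defensive.

Import Order.TTheory GRing.Theory Num.Theory.
Local Open Scope ring_scope.

Lemma coef_sqr_1subZX (R : comNzRingType) (a : R) (i : nat) :
  ((1 - a *: 'X : {poly R}) ^+ 2)`_i =
    (i == 0%N)%:R - 2 * a * (i == 1%N)%:R + a ^+ 2 * (i == 2%N)%:R.
Proof.
have -> : (1 - a *: 'X : {poly R}) ^+ 2 = 1 - (2 * a) *: 'X + (a ^+ 2) *: 'X^2.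
  by rewrite sqrrB expr1n mul1r exprZn scalerMnl mulr_natl.
by rewrite coefD coefB !coefZ coef1 coefX coefXn.
Qed.

(** Comparing coefficients in the power series identity gives [F 0 = 0], [F 1 = 1] and a two-term
    recurrence whose characteristic polynomial has the double root [alpha]. *)
Lemma is_N_closed_form (alpha : nat) (F : nat -> rat) :
  is_N alpha F -> forall n, F n = n%:R * alpha%:R ^+ n.-1.
Proof.
move=> [_ FE].
have F0 : F 0%N = 0.
  have := FE 0%N; rewrite big_ord1 coef_sqr_1subZX coefX /=.
  by rewrite !mulr0 subr0 addr0 mul1r.
have F1 : F 1%N = 1.
  have := FE 1%N; rewrite !big_ord_recl big_ord0 /= !coef_sqr_1subZX coefX /=.
  by rewrite F0 !(mulr0, addr0, subr0, mul1r).
have FS n : F n.+2 = 2 * alpha%:R * F n.+1 - alpha%:R ^+ 2 * F n.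
  have := FE n.+2; rewrite !big_ord_recl big1 => [|i _]; last first.
    by rewrite coef_sqr_1subZX /= /bump /= !(mulr0, addr0, subr0, mul0r).
  rewrite !coef_sqr_1subZX coefX /= /bump /= !subSS !subn0 addr0.
  rewrite !(mulr0, mulr1, addr0, subr0, sub0r, add0r, mul1r) => /eqP.
  by rewrite addr_eq0 => /eqP ->; ring.
elim/ltn_ind=> -[|[|n]] IH; first by rewrite F0 mul0r.
  by rewrite F1 mul1r expr0.
(* At [n = 0] the exponent [n.-1] is truncated, so this case is checked apart. *)
rewrite FS !IH //=; case: n {IH} => [|n] /=; first by ring.
by rewrite !exprS -[n.+3]addn3 -[n.+2]addn2 -[n.+1]addn1 !natrD; ring.
Qed.

Lemma Ffact_N (alpha : nat) (F : nat -> rat) (n : nat) :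
  is_N alpha F -> Ffact F n = n`!%:R * alpha%:R ^+ 'C(n, 2).
Proof.
move=> /is_N_closed_form FE; rewrite /Ffact.
elim: n => [|n IH]; first by rewrite big_nil mul1r.
rewrite big_nat_recr //= IH FE /= factS binS bin1 exprD natrM.
by ring.
Qed.

(** A pair in a disjoint union lies inside one part or is mixed; the mixed pairs become the exponent
    of [alpha] in the F-nomial coefficient. *)
Lemma bin2D (m n : nat) : 'C(m + n, 2) = ('C(m, 2) + 'C(n, 2) + m * n)%N.
Proof.
elim: m => [|m IH]; first by rewrite mul0n addn0.
by rewrite addSn !binS !bin1 IH mulSn !addnA; ring.
Qed.

Lemma Fnomial_N (alpha : nat) (F : nat -> rat) (n k : nat) : (0 < alpha)%N ->
  is_N alpha F -> Fnomial F n k = ('C(n, k) * alpha ^ (k * (n - k)))%:R.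
Proof.
move=> a0 FN; rewrite /Fnomial; case: leqP => [kn|nk]; last by rewrite bin_small.
(* Positivity of [alpha] makes the denominators nonzero, so the quotient can be cleared. *)
have nz m : Ffact F m != 0.
  by rewrite (Ffact_N m FN) mulf_neq0 ?expf_neq0 ?pnatr_eq0 -?lt0n ?fact_gt0 //.
apply: (canLR (mulfK _)); first by rewrite mulf_neq0.
rewrite !(Ffact_N _ FN) -(bin_fact kn).
have := bin2D k (n - k); rewrite subnKC // => ->; rewrite !exprD !natrM natrX.
by ring.
Qed.

Section CountMultiplicities.

Variables (T : finType) (A : {set T}) (a : nat).

Let D := setX A (~: A).

Definition multiplicities_across : {set {ffun T * T -> 'I_a.+1}} :=
  [set m : {ffun T * T -> 'I_a.+1} |
    [forall x, forall y, m (x, y) == m (y, x)] &&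
    [forall x, forall y, (0 < m (x, y))%N ==>
       ((x \in A) && (y \in ~: A)) || ((x \in ~: A) && (y \in A))]].

(** Meant for [f] vanishing off [D]: a pair inside one side is then sent to 0 by either branch. *)
Let symmetrize (f : {ffun T * T -> 'I_a.+1}) : {ffun T * T -> 'I_a.+1} :=
  [ffun p => if p.1 \in A then f p else f (p.2, p.1)].

Let restrict (m : {ffun T * T -> 'I_a.+1}) : {ffun T * T -> 'I_a.+1} :=
  [ffun p => if p \in D then m p else ord0].

(** A symmetric [m] without edges inside a side is determined by its values on [D], which are
    arbitrary. So [symmetrize] maps the functions supported on [D] bijectively onto these [m], with
    inverse [restrict]. *)
Lemma card_multiplicities_across :
  #|multiplicities_across| = (a.+1 ^ (#|A| * #|~: A|))%N.
Proof.
rewrite -cardsX -[in RHS](card_ord a.+1) -(card_pffun_on (ord0 : 'I_a.+1) (mem D)).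
set P := pffun_on _ _ _.
have PP (f : {ffun T * T -> 'I_a.+1}) : reflect (forall p, p \notin D -> f p = ord0) (f \in P).
  apply: (iffP pffun_onP) => [[sub _] p|f0].
    by apply: contraNeq => fp; apply: (subsetP sub).
  by split=> //; apply/subsetP => p; apply: contraR => /f0 /eqP.
have symK : {in P, cancel symmetrize restrict}.
  move=> f /PP f0; apply/ffunP => -[x y]; rewrite !ffunE /=.
  by case: ifPn => [|/f0 //]; rewrite !inE => /andP[-> _].
rewrite -(card_in_imset (can_in_inj symK)); apply: eq_card => m.
(* It remains to identify the image of [symmetrize]: each admissible [m] comes from [restrict m],
   and each [symmetrize f] is admissible. *)
apply/idP/imsetP => [|[f /PP f0 ->]]; rewrite !inE.
  move=> /andP[/forallP ms /forallP mD].
  have sm x y : m (x, y) = m (y, x) by move/forallP: (ms x) => /(_ y)/eqP.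
  have m0 x y : (x \in A) = (y \in A) -> m (x, y) = ord0.
    move=> xy; apply/val_inj/eqP; rewrite /= -leqn0 leqNgt.
    have /forallP/(_ y) := mD x; apply: contraTN => ->.
    by rewrite !inE xy; case: (y \in A).
  exists (restrict m).
    by apply/PP => p pD; rewrite ffunE (negPf pD).
  apply/ffunP => -[x y]; rewrite !ffunE /= !inE /=.
  case xA: (x \in A); case yA: (y \in A) => //=.
  - by rewrite m0 // xA yA.
  - by rewrite m0 // xA yA.
have g0 x y : (x \in A) = (y \in A) -> symmetrize f (x, y) = ord0.
  by move=> xy; rewrite ffunE /=; case: ifP => _; apply: f0; rewrite !inE /= xy andbN.
apply/andP; split; apply/forallP => x; apply/forallP => y.
  case xA: (x \in A); case yA: (y \in A).
  - by rewrite !g0 ?xA ?yA.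
  - by rewrite !ffunE /= xA yA.
  - by rewrite !ffunE /= xA yA.
  - by rewrite !g0 ?xA ?yA.
apply/implyP; apply: contraTT; rewrite !inE => h.
by rewrite g0 //; case: (x \in A) (y \in A) h => -[].
Qed.

End CountMultiplicities.

(** Covering and disjointness force the second class to be the complement of the first, and its size
    is then automatic. *)
Lemma is_bip_multigraphE (a n k : nat) (A B : {set 'I_n})
    (m : {ffun 'I_n * 'I_n -> 'I_a.+1}) :
  is_bip_multigraph k (A, B, m) =
    [&& #|A| == k, B == ~: A & m \in multiplicities_across A a].
Proof.
rewrite /is_bip_multigraph; have [->|BnA] := eqVneq B (~: A); last first.
  rewrite andbF; apply: contra_neqF BnA => /and3P[/eqP ABT dAB _].
  apply/setP => x; rewrite inE; have := in_setT x; rewrite -ABT inE.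
  by case xA: (x \in A) => //= _; rewrite (disjointFr dAB xA).
rewrite setUCr eqxx -setI_eq0 setICr eqxx /= inE.
have [kA|//] := eqVneq #|A| k.
by rewrite cardsCs setCK card_ord kA eqxx.
Qed.

Lemma betaE (alpha n k : nat) : (0 < alpha)%N ->
  beta alpha n k = ('C(n, k) * alpha ^ (k * (n - k)))%N.
Proof.
case: alpha => // a _; rewrite /beta.
transitivity (\sum_(A : {set 'I_n} | #|A| == k) #|multiplicities_across A a|)%N.
  under eq_bigr do rewrite -sum1_card.
  rewrite pair_big_dep -sum1_card /=.
  (* Forgetting the second class loses nothing, as it is recovered by complementation. *)
  rewrite (reindex_onto (fun q => (q.1, ~: q.1, q.2)) (fun g => (g.1.1, g.2))).
    apply: eq_bigl => -[A m] /=.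
    by rewrite inE is_bip_multigraphE !eqxx andbT.
  move=> [[A B] m] /=; rewrite inE is_bip_multigraphE.
  by case/and3P=> _ /eqP ->.
under eq_bigr => A /eqP kA.
  by rewrite card_multiplicities_across [#|~: A|]cardsCs setCK card_ord kA; over.
rewrite sum_nat_const -[X in 'C(X, k)]card_ord -card_draws.
by congr (_ * _)%N; apply: eq_card => A; rewrite !inE.
Qed.

Theorem corollary1 (alpha : nat) (halpha : (1 <= alpha)%N)
    (F : nat -> rat) (hF : is_N alpha F) :
  (F 0%N = 0 /\ forall n : nat, (1 <= n)%N -> F n = n%:R * alpha%:R ^+ (n - 1)) /\
  forall n k : nat, Fnomial F n k = (beta alpha n k)%:R.
Proof.
have FE := is_N_closed_form hF; split; last first.
  by move=> n k; rewrite (Fnomial_N _ _ halpha hF) betaE.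
by split=> [|n _]; rewrite FE ?mul0r // subn1.
Qed.
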